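(* Let $N\ge 1$ be an integer, let $a,b>0$ with $ab<1$, and let $n\ge 3$ be an odd integer with $n>\frac{2}{a}+1$. Let $G_n\in\mathbb{C}^{n^2\times n^2}$ be the truncated Gram matrix of the Gabor system generated by $g=s_N$ over $\Lambda_n=\{(ka,jb): j,k\in\mathcal{I}_n\}$, with blocks $G_n^{[\ell]}\in\mathbb{C}^{n\times n}$, $|\ell|\le n-1$. Then each block $G_n^{[\ell]}$, $|\ell|\le n-1$, can be written as a Hadamard (entrywise) product $$G_n^{[\ell]}=T_n^{[\ell]}\circ H_n^{[\ell]},$$ where $T_n^{[\ell]}\in\mathbb{R}^{n\times n}$ is a real-valued symmetric Toeplitz matrix and $H_n^{[\ell]}\in\mathbb{C}^{n\times n}$ is a rank-one Hankel matrix with unimodular entries (all entries of modulus $1$).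
   Context: B-splines: $s_1=\chi_{[-1/2,1/2]}$ and $s_N=s_1*s_{N-1}$ for $N\ge 2$. Index set: $\mathcal{I}_n=\{-\frac{n-1}{2},\dots,\frac{n-1}{2}\}$. Atoms: $g_{j,k}(x)=g(x-ka)e^{2\pi i jbx}$. Inner product: $\langle f,h\rangle=\int_{\mathbb{R}}f\,\overline{h}\,dx$. The truncated Gram matrix $G_n$ has entries $(G_n)_{(j,k),(j',k')}=\langle g_{j,k},g_{j',k'}\rangle$, $j,j',k,k'\in\mathcal{I}_n$. For $|\ell|\le n-1$, the block at modulation difference $\ell=j-j'$ is the $n\times n$ matrix $G_n^{[\ell]}$ with entries $(G_n^{[\ell]})_{k,k'}=\langle g_{j,k},g_{j-\ell,k'}\rangle=\int_{\mathbb{R}}g(x-ka)g(x-k'a)e^{2\pi i b\ell x}\,dx$, $k,k'\in\mathcal{I}_n$ (which does not depend on $j$). A matrix indexed by $k,k'\in\mathcal{I}_n$ is Toeplitz if its entries depend only on $k-k'$ and Hankel if its entries depend only on $k+k'$. *)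

(* Defs.v *)
From mathcomp Require Import all_boot all_order all_algebra.
From mathcomp Require Import complex.
From mathcomp Require Import all_classical all_reals all_analysis.

Set Implicit Arguments.
Unset Strict Implicit.
Unset Printing Implicit Defensive.

Import Order.TTheory GRing.Theory Num.Theory.
Import numFieldNormedType.Exports.

Local Open Scope classical_set_scope.
Local Open Scope ring_scope.
Local Open Scope complex_scope.

Section GaborGram.
Variable R : realType.

Definition conv (f h : R -> R) : R -> R :=
  fun x => \int[lebesgue_measure]_y (f y * h (x - y)).

Definition bspline1 : R -> R := \1_`[- (1 / 2), 1 / 2].

(* The B-spline s_N for N >= 1; N = 0 is a dummy value equal to s_1. *)
Definition bspline (N : nat) : R -> R := iter N.-1 (conv bspline1) bspline1.

Definition cexpi (t : R) : R[i] := cos t +i* sin t.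

(* MathComp-Analysis only integrates real functions, so complex integrals
   are taken componentwise. *)
Definition cintegral (f : R -> R[i]) : R[i] :=
  (\int[lebesgue_measure]_x complex.Re (f x))
    +i* (\int[lebesgue_measure]_x complex.Im (f x)).

Definition cinner (f h : R -> R[i]) : R[i] :=
  cintegral (fun x => f x * (h x)^*).

(* The i-th element (counting from 0) of {-(n-1)/2, ..., (n-1)/2}. *)
Definition symidx (n : nat) (i : 'I_n) : R := i%:R - (n%:R - 1) / 2.

Definition atom (g : R -> R) (a b j k : R) : R -> R[i] :=
  fun x => (g (x - k * a))%:C * cexpi (2 * pi * j * b * x).

(* The inverse of [mxvec_index]: an element of 'I_(n * n) as a pair (j, k) of
   a modulation index and a translation index. *)
Definition mxvec_pair (n : nat) (p : 'I_(n * n)) : 'I_n * 'I_n :=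
  enum_val (cast_ord (esym (mxvec_cast n n)) p).

Definition gram_matrix (g : R -> R) (a b : R) (n : nat) : 'M[R[i]]_(n * n) :=
  \matrix_(p, q)
    cinner (atom g a b (symidx (mxvec_pair p).1) (symidx (mxvec_pair p).2))
           (atom g a b (symidx (mxvec_pair q).1) (symidx (mxvec_pair q).2)).

Definition submatrix_at (n : nat) (G : 'M[R[i]]_(n * n)) (j j' : 'I_n)
    : 'M[R[i]]_n :=
  mxsub (mxvec_index j) (mxvec_index j') G.

Definition gram_block (g : R -> R) (a b : R) (n : nat) (l : int)
    : 'M[R[i]]_n :=
  \matrix_(k, k')
    cintegral (fun x => (g (x - symidx k * a) * g (x - symidx k' * a))%:C
                        * cexpi (2 * pi * b * l%:~R * x)).

Definition hadamard (n : nat) (A B : 'M[R[i]]_n) : 'M[R[i]]_n :=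
  map2_mx *%R A B.

Definition toeplitz (K : Type) (n : nat) (A : 'M[K]_n) : Prop :=
  forall k1 k1' k2 k2' : 'I_n,
    symidx k1 - symidx k1' = symidx k2 - symidx k2' -> A k1 k1' = A k2 k2'.

Definition hankel (K : Type) (n : nat) (A : 'M[K]_n) : Prop :=
  forall k1 k1' k2 k2' : 'I_n,
    symidx k1 + symidx k1' = symidx k2 + symidx k2' -> A k1 k1' = A k2 k2'.

Lemma mxvec_indexK (n : nat) (j k : 'I_n) :
  mxvec_pair (mxvec_index j k) = (j, k).
Proof. by rewrite /mxvec_pair /mxvec_index cast_ordK enum_rankK. Qed.

Lemma submatrix_atE (g : R -> R) (a b : R) (n : nat) (j k j' k' : 'I_n) :
  submatrix_at (gram_matrix g a b n) j j' k k'
  = cinner (atom g a b (symidx j) (symidx k))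
           (atom g a b (symidx j') (symidx k')).
Proof. by rewrite !mxE !mxvec_indexK. Qed.

End GaborGram.

Arguments bspline R N _ : clear implicits.
Arguments symidx R {n} i.
Arguments toeplitz R {K n} A.
Arguments hankel R {K n} A.

(* Main.v *)
(** Put w = 2 pi b l, p = k a, q = k' a. Translating by the midpoint
    (p + q) / 2 turns the integrand g(x - p) g(x - q) e^{iwx} into
    P(x) e^{iwx} e^{iw(p + q)/2}, where P(x) = g(x - d) g(x + d) with
    d = (p - q) / 2. Since the B-spline g is even, so is P: the sine part of
    the integral of P(x) e^{iwx} vanishes and its cosine part depends only on
    |p - q|, which gives the real symmetric Toeplitz factor. The phase
    e^{iw(p + q)/2} = e^{iwp/2} e^{iwq/2} is the rank-one Hankel factor. *)

Require Import Defs.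
From mathcomp Require Import all_boot all_order all_algebra.
From mathcomp Require Import complex.
From mathcomp Require Import all_classical all_reals all_analysis.
From mathcomp Require Import measurable_realfun ring lra.

Set Implicit Arguments.
Unset Strict Implicit.
Unset Printing Implicit Defensive.

Import Order.TTheory GRing.Theory Num.Theory.

Import numFieldNormedType.Exports.

Local Open Scope classical_set_scope.
Local Open Scope ring_scope.

(** * Invariance of the Lebesgue integral under translation and reflection *)

Section RealIntegrals.
Variable R : realType.
Implicit Types (f g h : R -> R) (c d r t w x M : R).
Local Notation mu := (@lebesgue_measure R).

(** The positive and negative parts of [f] are transported separately by the change of variables for
    nonnegative functions, so measurability of [f] suffices. *)
Lemma Rintegral_measure_preserving (phi : R -> R) f :
  measurable_fun setT phi ->
  (forall A : set (measurableTypeR R),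
     measurable A -> pushforward mu (phi : _ -> measurableTypeR R) A = mu A) ->
  measurable_fun setT f ->
  \int[mu]_x f (phi x) = \int[mu]_x f x.
Proof.
move=> mphi phiE mf; rewrite /Rintegral; congr fine.
have ge0 (u : R -> \bar R) : measurable_fun [set: R] u -> (forall x, 0 <= u x)%E ->
    (\int[mu]_x u (phi x) = \int[mu]_x u x)%E.
  move=> mu_ u0.
  have /= <- := @ge0_integral_pushforward _ _ (measurableTypeR R)
    (measurableTypeR R) R phi mphi mu setT u measurableT mu_ (fun y _ => u0 y).
  by apply: eq_measure_integral => A mA _; exact: phiE.
have mEf : measurable_fun setT (EFin \o f) by exact/measurable_EFinP.
rewrite integralE [RHS]integralE.
rewrite -[in RHS]ge0//; last exact: measurable_funepos.
rewrite -[X in _ = (_ - X)%E]ge0//; last exact: measurable_funeneg.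
by congr (_ - _)%E; apply: eq_integral => x _; rewrite ?funeposE ?funenegE.
Qed.

(** Lebesgue measure is the only measure giving half-open intervals their length, and translation
    preserves these lengths. *)
Lemma lebesgue_measure_translate c (A : set (measurableTypeR R)) :
  measurable A ->
  pushforward mu ((fun x => x + c) : _ -> measurableTypeR R) A = mu A.
Proof.
move=> mA; apply/esym; apply: lebesgue_measure_unique => //=.
  exact: measurable_funD.
move=> _ _ [[a b]] _ <-; rewrite /pushforward.
rewrite (_ : _ @^-1` _ = `]a - c, b - c]%classic); last first.
  by apply/seteqP; split=> x /=; rewrite !in_itv/= ltrBlDr lerBrDr.
rewrite !lebesgue_measure_itv/= !lte_fin ltrD2r.
by case: ifP => // _; rewrite -!EFinB; congr _%:E; ring.
Qed.

Lemma Rintegral_translate c f : measurable_fun setT f ->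
  \int[mu]_x f (x + c) = \int[mu]_x f x.
Proof.
move=> mf; apply: (@Rintegral_measure_preserving (fun x => x + c)) => //.
  exact: measurable_funD.
exact: lebesgue_measure_translate.
Qed.

Lemma Rintegral_oppr f : measurable_fun setT f ->
  \int[mu]_x f (- x) = \int[mu]_x f x.
Proof.
move=> mf; apply: (@Rintegral_measure_preserving -%R) => //.
exact: lebesgue_measureN.
Qed.

Lemma Rintegral_odd f : measurable_fun setT f ->
  (forall x, f (- x) = - f x) -> mu.-integrable setT (EFin \o f) ->
  \int[mu]_x f x = 0.
Proof.
move=> mf fN fi.
have : \int[mu]_x f x = - \int[mu]_x f x.
  rewrite -[LHS]Rintegral_oppr// -mulN1r -RintegralZl//.
  by apply: eq_Rintegral => x _; rewrite fN mulN1r.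
by move=> h; lra.
Qed.

(** * Integrability and regularity of B-splines *)

Lemma integrable_bounded_support f M : measurable_fun setT f ->
  (forall x, `|f x| <= 1) -> (forall x, M < `|x| -> f x = 0) ->
  mu.-integrable setT (EFin \o f).
Proof.
move=> mf f1 fM.
(* The indicator of [[- M, M]] serves as the dominating function. *)
have i1 : mu.-integrable setT (EFin \o (\1_`[- M, M] : R -> R)).
  apply/integrableP; split; first exact/measurable_EFinP/measurable_indic.
  under eq_integral do rewrite /= ger0_norm//.
  rewrite integral_indic// setIT /= lebesgue_measure_itv/=.
  by case: ifP => // _; rewrite -EFinB ltry.
apply: (le_integrable _ _ _ i1) => //; first exact/measurable_EFinP.
move=> x _ /=; rewrite lee_fin indicE.
have [xM|] := boolP (x \in `[- M, M]%classic); first by rewrite normr1 f1.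
rewrite notin_setE/= in_itv/= => /negP.
by rewrite -ler_norml -ltNge => /fM ->; rewrite normr0.
Qed.

(* An invariant preserved by convolution with s_1 and by the autocorrelation
   products below, strong enough for all the integrals to converge. *)
Record window g : Prop := Window {
  window_measurable : measurable_fun setT g;
  window_even : forall x, g (- x) = g x;
  window_ge0 : forall x, 0 <= g x;
  window_le1 : forall x, g x <= 1;
  window_support : exists M, forall x, M < `|x| -> g x = 0 }.

Lemma window_bspline1 : window (@bspline1 R).
Proof.
split.
- exact: measurable_indic.
- move=> x; rewrite /bspline1 !indicE; congr (_%:R); congr nat_of_bool.
  by apply/idP/idP; rewrite !inE/= !in_itv/= => /andP[? ?]; apply/andP; lra.
- by move=> x; rewrite /bspline1 indicE.
- by move=> x; rewrite /bspline1 indicE lern1; case: (_ \in _).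
- exists (1 / 2) => x xM; rewrite /bspline1 indicE.
  case: (boolP (_ \in _)) => //; rewrite inE/= in_itv/= -ler_norml.
  by rewrite leNgt xM.
Qed.

(** By Tonelli, integrating out one variable of a nonnegative measurable function leaves a
    measurable function of the other. *)
Lemma measurable_conv f h : measurable_fun setT f -> measurable_fun setT h ->
  (forall x, 0 <= f x) -> (forall x, 0 <= h x) -> measurable_fun setT (Defs.conv f h).
Proof.
move=> mf mh f0 h0.
pose F (z : measurableTypeR R * measurableTypeR R) :=
  (f z.2 * h (z.1 - z.2))%:E.
apply: (@measurableT_comp _ _ _ _ _ _ fine _ (fubini_F mu F)).
  exact: fine_measurable.
apply: measurable_fun_fubini_tonelli_F.
  apply/measurable_EFinP/measurable_funM.
    by apply: measurableT_comp => //; exact: measurable_snd.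
  apply: measurableT_comp => //; apply: measurable_funB.
    exact: measurable_fst.
  exact: measurable_snd.
by move=> z; rewrite lee_fin mulr_ge0.
Qed.

(** Since [0 <= h <= 1], the integrand lies between 0 and [bspline1], whose integral is 1; this
    gives convergence and the upper bound. Evenness comes from substituting [- y] for [y], and the
    support radius grows by 1/2. *)
Lemma window_conv h : window h -> window (Defs.conv (@bspline1 R) h).
Proof.
move=> wh.
have [mb bN b0 b1 _] := window_bspline1; have [mh hN h0 h1 [M hM]] := wh.
have mk x : measurable_fun setT (fun y => bspline1 y * h (x - y)).
  apply: measurable_funM => //; apply: measurableT_comp => //.
  exact: measurable_funB.
have bi : mu.-integrable setT (EFin \o @bspline1 R).
  apply: (@integrable_bounded_support _ (1 / 2)) => // x.
    by rewrite ger0_norm.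
  move=> xM; rewrite /bspline1 indicE.
  case: (boolP (_ \in _)) => //; rewrite inE/= in_itv/= -ler_norml.
  by rewrite leNgt xM.
have le x y : bspline1 y * h (x - y) <= bspline1 y.
  by rewrite -[leRHS]mulr1 ler_wpM2l.
have ki x : mu.-integrable setT (EFin \o (fun y => bspline1 y * h (x - y))).
  apply: (le_integrable _ _ _ bi) => //.
    by apply/measurable_EFinP; exact: mk.
  by move=> y _ /=; rewrite lee_fin !ger0_norm// mulr_ge0.
split.
- exact: measurable_conv.
- move=> x; rewrite /Defs.conv -[RHS](Rintegral_oppr (mk x)).
  by apply: eq_Rintegral => y _; rewrite bN -(hN (x - - y)); congr (_ * h _); ring.
- by move=> x; apply: Rintegral_ge0 => y _; exact: mulr_ge0.
- move=> x; apply: (@le_trans _ _ (\int[mu]_y bspline1 y)).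
    exact: le_Rintegral.
  rewrite /Rintegral /bspline1 integral_indic// setIT /= lebesgue_measure_itv/=.
  rewrite lte_fin; case: ifP => //= _; lra.
- exists (M + 1 / 2) => x xM.
  rewrite /Defs.conv (_ : (fun y => _) = cst 0) ?Rintegral_cst ?mul0r//.
  apply/funext => y /=; rewrite /bspline1 indicE.
  case: (boolP (_ \in _)); last by rewrite mul0r.
  rewrite inE/= in_itv/= -ler_norml => y2; rewrite hM ?mulr0//.
  by have := lerB_dist x y; lra.
Qed.

Lemma window_bspline N : window (bspline R N).
Proof.
rewrite /bspline; elim: N.-1 => [|k IH] /=; first exact: window_bspline1.
exact: window_conv.
Qed.

Lemma window_prod_translates g d : window g ->
  window (fun x => g (x - d) * g (x + d)).
Proof.
move=> [mg gN g0 g1 [M gM]]; split.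
- apply: measurable_funM; apply: measurableT_comp => //.
    exact: measurable_funB.
  exact: measurable_funD.
(* Reflection exchanges the two factors, because [g] is even. *)
- move=> x; rewrite mulrC -(gN (- x + d)) -(gN (- x - d)).
  by congr (g _ * g _); ring.
- by move=> x; exact: mulr_ge0.
- by move=> x; rewrite -[1]mulr1 ler_pM.
- exists (M + `|d|) => x xM; rewrite (gM (x - d)) ?mul0r//.
  by have := lerB_dist x d; lra.
Qed.

Lemma window_integrableM f (u : R -> R) : window f -> measurable_fun setT u ->
  (forall x, `|u x| <= 1) -> mu.-integrable setT (EFin \o (fun x => f x * u x)).
Proof.
move=> [mf _ f0 f1 [M fM]] mu_ u1.
apply: (@integrable_bounded_support _ M).
- exact: measurable_funM.
- by move=> x; rewrite normrM -[1]mulr1 ler_pM// ger0_norm.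
- by move=> x xM; rewrite fM ?mul0r.
Qed.

(** * Fourier integrals of even windows and phase factors *)

(** For an even window this is the whole Fourier integral of [f] against e^{iwx}, which is therefore
    real. *)
Definition cos_transform f w : R := \int[mu]_x (f x * cos (w * x)).

Lemma cintegral_shifted_phase f w t : window f ->
  cintegral (fun x => (f x)%:C%C * cexpi (w * x + t))
  = ((cos_transform f w)%:C * cexpi t)%C.
Proof.
move=> wf; have [mf fN _ _ _] := wf.
have mwx : measurable_fun setT (fun x => w * x) by exact: measurable_funM.
have mC : measurable_fun setT (fun x => cos (w * x)).
  apply: (measurableT_comp _ mwx).
  by apply: continuous_measurable_fun; exact: continuous_cos.
have mS : measurable_fun setT (fun x => sin (w * x)).
  apply: (measurableT_comp _ mwx).
  by apply: continuous_measurable_fun; exact: continuous_sin.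
have normC r : `|cos r| <= 1 by rewrite ler_norml cos_geN1 cos_le1.
have normS r : `|sin r| <= 1 by rewrite ler_norml sin_geN1 sin_le1.
have iC := window_integrableM wf mC (fun x => normC _).
have iS := window_integrableM wf mS (fun x => normS _).
have S0 : \int[mu]_x (f x * sin (w * x)) = 0.
  apply: Rintegral_odd => //; first exact: measurable_funM.
  by move=> x; rewrite fN mulrN sinN mulrN.
(* By the addition formulas, the real part is the case [r = cos t], [s = - sin t], and the imaginary
   part the case [r = sin t], [s = cos t]. *)
have lin r s : \int[mu]_x (r * (f x * cos (w * x)) + s * (f x * sin (w * x)))
    = r * cos_transform f w.
  rewrite RintegralD//=.
  - by rewrite !RintegralZl// S0 mulr0 addr0.
  - exact: (integrableZl _ r iC).
  - exact: (integrableZl _ s iS).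
rewrite /cintegral /cexpi; apply/eqP; rewrite eq_complex /=; apply/andP; split.
  apply/eqP; rewrite !mul0r !subr0 mulrC -(lin _ (- sin t)).
  by apply: eq_Rintegral => x _; rewrite cosD mul0r subr0; ring.
apply/eqP; rewrite !mul0r !addr0 mulrC -(lin _ (cos t)).
by apply: eq_Rintegral => x _; rewrite sinD mul0r addr0; ring.
Qed.

Lemma cexpiD t r : cexpi (t + r) = cexpi t * cexpi r.
Proof.
rewrite /cexpi cosD sinD; apply/eqP; rewrite eq_complex/= eqxx /=.
by apply/eqP; ring.
Qed.

Lemma conj_realM_cexpi r t :
  Num.conj (r%:C%C * cexpi t) = r%:C%C * cexpi (- t).
Proof.
rewrite -[LHS]/(conjc _).
by rewrite /cexpi cosN sinN; apply/eqP; rewrite eq_complex/=; apply/andP; split;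
  apply/eqP; ring.
Qed.

Lemma normc_cexpi t : `|cexpi t| = 1.
Proof. by rewrite normc_def /= cos2Dsin2 sqrtr1. Qed.

Lemma cintegral_translate c (F : R -> R[i]) :
  measurable_fun setT (fun x => complex.Re (F x)) ->
  measurable_fun setT (fun x => complex.Im (F x)) ->
  cintegral (fun x => F (x + c)) = cintegral F.
Proof.
by move=> mr mi; rewrite /cintegral (Rintegral_translate c mr)
  (Rintegral_translate c mi).
Qed.

Lemma cintegral_window_translates g (p q w : R) : window g ->
  cintegral (fun x => (g (x - p) * g (x - q))%:C%C * cexpi (w * x))
  = ((cos_transform (fun x => g (x - (p - q) / 2) * g (x + (p - q) / 2)) w)%:C
     * cexpi (w * ((p + q) / 2)))%C.
Proof.
move=> wg; rewrite -cintegral_shifted_phase; last exact: window_prod_translates.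
have mg := window_measurable wg.
have mP : measurable_fun setT (fun x => g (x - p) * g (x - q)).
  by apply: measurable_funM; apply: measurableT_comp => //; exact: measurable_funB.
have mwx : measurable_fun setT (fun x => w * x) by exact: measurable_funM.
(* The midpoint shift turns [x - p] and [x - q] into [x - (p - q) / 2] and [x + (p - q) / 2], and
   adds [w * ((p + q) / 2)] to the phase. *)
rewrite -(@cintegral_translate ((p + q) / 2)).
- congr cintegral; apply/funext => x; congr (_%:C%C * cexpi _); last by ring.
  by congr (g _ * g _); field.
- rewrite (_ : (fun x => _) = (fun x => g (x - p) * g (x - q) * cos (w * x))).
    apply: measurable_funM => //; apply: (measurableT_comp _ mwx).
    by apply: continuous_measurable_fun; exact: continuous_cos.
  by apply/funext => x /=; rewrite mul0r subr0.
- rewrite (_ : (fun x => _) = (fun x => g (x - p) * g (x - q) * sin (w * x))).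
    apply: measurable_funM => //; apply: (measurableT_comp _ mwx).
    by apply: continuous_measurable_fun; exact: continuous_sin.
  by apply/funext => x /=; rewrite mul0r addr0.
Qed.

End RealIntegrals.

(** * Rank-one matrices and the factorization of the blocks *)

Lemma mxrank_outer_prod (F : fieldType) n (u : 'I_n -> F) (i : 'I_n) :
  u i != 0 -> \rank (\matrix_(k, k') (u k * u k')) = 1%N.
Proof.
move=> ui; apply/eqP; rewrite eqn_leq; apply/andP; split.
  (* A column times a row has rank at most 1; below, the diagonal entry [u i * u i] excludes rank
     0. *)
  rewrite (_ : \matrix_(_, _) _ = (\col_k u k) *m (\row_k u k)).
    exact: mulmx_max_rank.
  by apply/matrixP => k k'; rewrite !mxE big_ord1 !mxE.
rewrite lt0n mxrank_eq0; apply/eqP => /matrixP /(_ i i); rewrite !mxE.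
by apply/eqP; rewrite mulf_neq0.
Qed.

Theorem theorem3p3 (R : realType) (N : nat) (a b : R) (n : nat)
  (hN : (1 <= N)%N) (ha : 0 < a) (hb : 0 < b) (hab : a * b < 1)
  (hn3 : (3 <= n)%N) (hodd : odd n) (hna : 2 / a + 1 < n%:R)
  (l : int) (hl : `|l| <= n%:Z - 1) :
  (* the blocks of G_n at modulation difference l all equal G_n^[l] *)
  (forall j j' : 'I_n, symidx R j - symidx R j' = l%:~R ->
     submatrix_at (gram_matrix (bspline R N) a b n) j j'
     = gram_block (bspline R N) a b n l) /\
  (exists (T : 'M[R]_n) (H : 'M[R[i]]_n),
     [/\ T^T = T /\ toeplitz R T,
         hankel R H,
         \rank H = 1%N,
         (forall k k' : 'I_n, `|H k k'| = 1)
       & gram_block (bspline R N) a b n l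
         = hadamard (map_mx (real_complex R) T) H]).
Proof.
have wg := window_bspline R N; set g := bspline R N in wg *.
split=> [j j' jj'|].
  apply/matrixP => k k'; rewrite submatrix_atE mxE /cinner /atom.
  congr cintegral; apply/funext => x.
  (* Conjugation negates the phase of the second atom, so only the difference of the modulation
     indices, which is [l], survives. *)
  rewrite -jj' conj_realM_cexpi mulrACA -cexpiD -rmorphM; congr (_ * cexpi _); ring.
pose w := 2 * pi * b * l%:~R.
pose u (k : 'I_n) : R[i] := cexpi (w * (symidx R k * a / 2)).
exists (\matrix_(k, k') let d := (symidx R k - symidx R k') * a / 2 in
          cos_transform (fun x => g (x - d) * g (x + d)) w).
exists (\matrix_(k, k') cexpi (w * ((symidx R k + symidx R k') * a / 2))).
have HE (k k' : 'I_n) :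
    cexpi (w * ((symidx R k + symidx R k') * a / 2)) = u k * u k'.
  by rewrite /u -cexpiD; congr cexpi; ring.
split.
- split; last by move=> k1 k1' k2 k2' e; rewrite !mxE e.
  (* Swapping [k] and [k'] negates [d], which merely exchanges the factors [g (x - d)] and
     [g (x + d)]. *)
  apply/matrixP => k k'; rewrite !mxE /=; congr cos_transform.
  by apply/funext => x; rewrite mulrC; congr (g _ * g _); ring.
- by move=> k1 k1' k2 k2' e; rewrite !mxE e.
- rewrite (_ : \matrix_(_, _) _ = \matrix_(k, k') (u k * u k')).
    (* Index 0 exists because [3 <= n], and [u] vanishes nowhere, its values being unimodular. *)
    apply: (@mxrank_outer_prod _ _ _ (Ordinal (ltnW (ltnW hn3)))).
    by rewrite -normr_eq0 normc_cexpi oner_neq0.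
  by apply/matrixP => k k'; rewrite !mxE HE.
- by move=> k k'; rewrite mxE normc_cexpi.
- apply/matrixP => k k'; rewrite !mxE /=.
  rewrite -/w cintegral_window_translates//.
  by rewrite -!mulrDl -!mulrBl.
Qed.
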